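(* Let $n = 3$. Suppose $(\mu, \Sigma)$ and $(\mu', \Sigma')$ both satisfy the normalization below. Let $X \sim \mathcal{N}(\mu, \Sigma)$ and $X' \sim \mathcal{N}(\mu', \Sigma')$, and suppose that for every permutation $(i,j,k)$ of $\{1,2,3\}$, $$\Pr\{X_i \geq X_j \geq X_k\} = \Pr\{X'_i \geq X'_j \geq X'_k\}.$$ Then $\mu = \mu'$ and $\Sigma = \Sigma'$. In words, $(\mu,\Sigma)$ is uniquely identifiable from the three-way observation probabilities.
   Context: Probit model: utilities $X \sim \mathcal{N}(\mu, \Sigma)$ with $\mu \in \mathbb{R}^n$ and $\Sigma$ symmetric positive semidefinite. Normalization: $\langle \mu, \mathbf{1}\rangle = 0$, $\Sigma\mathbf{1} = 0$, $\operatorname{Tr}(\Sigma) = n$, and $\operatorname{rank}(\Sigma) = n-1$. The three-way observation probabilities are the probabilities of each of the six orderings of $(X_1, X_2, X_3)$. *)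

(* Defs.v *)
From HB Require Import structures.
From mathcomp Require Import all_boot all_order all_algebra.
From mathcomp Require Import all_classical all_reals all_analysis.
Set Implicit Arguments. Unset Strict Implicit. Unset Printing Implicit Defensive.
Import Order.TTheory GRing.Theory Num.Theory.
Local Open Scope classical_set_scope.
Local Open Scope ring_scope.

Definition gauss_law (R : realType) (m v : R) : set R -> \bar R :=
  if v == 0 then (\d_m : set R -> \bar R) else normal_prob m (Num.sqrt v).

(* X = (X_0,...,X_{n-1}) on the probability space (T,P) is distributed as
   N(mu, S): each X_i is measurable, and every linear combination t.X has
   law N(t.mu, t^T S t) (Cramer-Wold definition, allows singular S). *)
Definition is_gaussian_vector (R : realType) (d : measure_display)
  (T : measurableType d) (P : probability T R) (n : nat)
  (X : 'I_n -> T -> R) (mu : 'I_n -> R) (S : 'M[R]_n) : Prop :=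
  (forall i, measurable_fun setT (X i)) /\
  forall (t : 'I_n -> R) (A : set R), measurable A ->
    P ((fun w => \sum_(i < n) t i * X i w) @^-1` A) =
    gauss_law (\sum_(i < n) t i * mu i)
              (\sum_(i < n) \sum_(j < n) t i * S i j * t j) A.

Definition probit_normalized (R : realType) (n : nat)
  (mu : 'I_n -> R) (S : 'M[R]_n) : Prop :=
  \sum_(i < n) mu i = 0 /\
  S^T = S /\
  (forall v : 'rV[R]_n, 0 <= (v *m S *m v^T) ord0 ord0) /\
  (forall i : 'I_n, \sum_(j < n) S i j = 0) /\
  \tr S = n%:R /\
  \rank S = n.-1.

(* Main.v *)
Require Import Defs.
From HB Require Import structures.
From mathcomp Require Import all_boot all_order all_algebra.
From mathcomp Require Import all_classical all_reals all_analysis.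
From mathcomp Require Import measurable_realfun ring lra.
Set Implicit Arguments. Unset Strict Implicit. Unset Printing Implicit Defensive.
Import Order.TTheory GRing.Theory Num.Theory.
Import numFieldNormedType.Exports.
Local Open Scope classical_set_scope.
Local Open Scope ring_scope.

(** The probability of [X_i >= X_j] determines the standardized mean difference
    [(mu_i - mu_j) / sd (X_i - X_j)].  Given these, the probability of
    [X_i >= X_j >= X_k] is a strictly increasing function of the correlation of
    [X_i - X_j] and [X_j - X_k], hence determines it.  The three correlations are
    cosines in the triangle with sides [sd (X_i - X_j)]: they fix it up to scale,
    the trace fixes the scale, and then the means follow.

    Monotonicity in the correlation: in standardized coordinates [(U, V)], two
    correlations [r < r'] correspond to two half-planes of equal mass whose
    boundary lines cross, cut by a vertical line.  Their difference on one side of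
    the cut contains a cone, and cones have positive mass because countably many
    rotations of a cone cover a half-plane.  Both this rotation invariance and the
    transfer between probability spaces rest on the fact that the laws of all
    projections determine the mass of a quadrant, whose indicator is a bounded
    limit of trigonometric polynomials. *)

(** * Approximating the unit step by polynomials in a sine *)

Section step_approximation.
Context {R : realType}.
Implicit Types x y z s t : R.

(** The mean value theorem, since the derivative [cos] stays above 1/2 near 0. *)
Lemma sin_ge_half_near0 :
  exists2 d : R, 0 < d & forall t, 0 <= t <= d -> t / 2 <= sin t.
Proof.
have : \forall t \near (0 : R), 1 / 2 < cos t.
  have /cvgr_gt := @continuous_cos R 0.
  by apply; rewrite cos0; lra.
move=> /nbhs_ballP[e /= e0 he]; exists (e / 2); first lra.
move=> t /andP[t0 te].
have [->|tn0] := eqVneq t 0; first by rewrite sin0; lra.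
have t_gt0 : 0 < t by rewrite lt_neqAle eq_sym tn0.
have sin_cont : {within `[0, t], continuous (@sin R)}.
  by apply: continuous_subspaceT => x; exact: continuous_sin.
have [c cin] := MVT t_gt0 (fun x _ => is_derive_sin x) sin_cont.
rewrite sin0 !subr0 => ->.
have {}cin : 0 < c < t by move: cin; rewrite in_itv.
have : 1 / 2 < cos c by apply: he; rewrite /ball/= sub0r normrN gtr0_norm; lra.
by nra.
Qed.

Lemma bernoulli_onemX z (k : nat) : 0 <= z <= 1 -> 1 - (1 - z) ^+ k <= k%:R * z.
Proof.
move=> z01; elim: k => [|k IH]; first by rewrite expr0 mul0r subrr.
rewrite exprS -natr1.
have : 0 <= (1 - z) ^+ k by apply: exprn_ge0; lra.
have : (1 - z) ^+ k <= 1 by apply: exprn_ile1; lra.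
by nra.
Qed.

(** The product decreases in [k], because [(1 - z) * (1 + (k + 1) * z) <= 1 + k * z]. It is used as
    an upper bound on the power. *)
Lemma onemX_decay z (k : nat) :
  0 <= z <= 1 -> (1 - z) ^+ k * (1 + k%:R * z) <= 1.
Proof.
move=> z01; elim: k => [|k IH]; first by rewrite expr0 mul0r addr0 mulr1.
rewrite exprS -natr1.
have : 0 <= (1 - z) ^+ k by apply: exprn_ge0; lra.
set p := (1 - z) ^+ k in IH *; move=> p0.
apply: le_trans IH; rewrite (mulrC (1 - z)) -mulrA ler_wpM2l//.
have : 0 <= (k%:R : R) by [].
by nra.
Qed.

(** Left of 0 the step is bounded by [m / (m^3 * s)], where the size [s] of the sine is of order
    [|x| / m]. The cube makes this bound tend to 0; a square would leave it constant. *)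
Definition wave_exp (m : nat) : nat := (m ^ 3)%N.

(* The exponent is [m] times the critical value [2 ^ wave_exp m], so that the
   limit at [x = 0] is exactly 1. *)
Definition smooth_step (m : nat) (x : R) : R :=
  1 - (1 - ((1 + sin (m%:R^-1 * x)) / 2) ^+ wave_exp m) ^+ (m * 2 ^ wave_exp m).

Lemma half_wave_itv t : 0 <= (1 + sin t) / 2 <= 1.
Proof. by have := sin_geN1 t; have := sin_le1 t; lra. Qed.

Lemma half_waveX_itv t n : 0 <= ((1 + sin t) / 2) ^+ n <= 1.
Proof.
have /andP[h0 h1] := half_wave_itv t.
by rewrite exprn_ge0// exprn_ile1.
Qed.

Lemma smooth_step_itv m x : 0 <= smooth_step m x <= 1.
Proof.
rewrite /smooth_step; set z := _ ^+ wave_exp m.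
have /andP[z0 z1] : 0 <= z <= 1 by exact: half_waveX_itv.
have : 0 <= (1 - z) ^+ (m * 2 ^ wave_exp m) by apply: exprn_ge0; lra.
have : (1 - z) ^+ (m * 2 ^ wave_exp m) <= 1 by apply: exprn_ile1; lra.
by lra.
Qed.

(** The factor [2 ^ wave_exp m] cancels the halving. What remains is at least [m] for a nonnegative
    sine, and is damped by the power for a negative one. *)
Lemma critical_exponent m t :
  (m * 2 ^ wave_exp m)%:R * ((1 + sin t) / 2) ^+ wave_exp m =
  m%:R * (1 + sin t) ^+ wave_exp m.
Proof.
rewrite natrM natrX -mulrA -exprMn; congr (_ * _ ^+ _).
by field.
Qed.

Lemma smooth_step_ge m x : 0 <= sin (m%:R^-1 * x) ->
  1 - (1 + m%:R)^-1 <= smooth_step m x.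
Proof.
move=> s0; rewrite /smooth_step lerD2l lerN2.
set z := _ ^+ wave_exp m.
have := @onemX_decay z (m * 2 ^ wave_exp m) (half_waveX_itv _ _).
rewrite critical_exponent.
set p := (1 - z) ^+ _; set e := (1 + sin _) ^+ _ => pe.
have e1 : 1 <= e by apply: exprn_ege1; lra.
have p0 : 0 <= p.
  by apply: exprn_ge0; have /andP[] := half_waveX_itv (m%:R^-1 * x) (wave_exp m); rewrite -/z; lra.
have m0 : 0 <= (m%:R : R) by [].
rewrite -[leRHS]mul1r ler_pdivlMr; last lra.
apply: le_trans pe; apply: ler_wpM2l => //; nra.
Qed.

(** With [s] minus the sine, Bernoulli bounds the step by [m * (1 - s) ^ (m^3)], and [onemX_decay]
    bounds the power by [1 / (m^3 * s)]. *)
Lemma smooth_step_le m x : (0 < m)%N -> 0 < - sin (m%:R^-1 * x) ->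
  smooth_step m x <= (m%:R ^+ 2 * - sin (m%:R^-1 * x))^-1.
Proof.
move=> m0 s0; rewrite /smooth_step.
apply: (le_trans (bernoulli_onemX _ (half_waveX_itv _ _))).
rewrite critical_exponent.
set s := - sin _ in s0 *.
have -> : 1 + sin (m%:R^-1 * x) = 1 - s by rewrite /s opprK.
have s01 : 0 <= s <= 1.
  by rewrite ltW//= /s; have := sin_geN1 (m%:R^-1 * x); lra.
have := onemX_decay (wave_exp m) s01.
have : 0 <= (1 - s) ^+ wave_exp m by apply: exprn_ge0; lra.
set p := (1 - s) ^+ _; rewrite /wave_exp natrX => p0 hp.
have mr0 : 0 < (m%:R : R) by rewrite ltr0n.
rewrite -[leRHS]mul1r ler_pdivlMr; last by rewrite mulr_gt0// exprn_gt0.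
have -> : m%:R * p * (m%:R ^+ 2 * s) = p * (m%:R ^+ 3 * s) by ring.
by apply: le_trans hp; nra.
Qed.

(** For fixed [x], the argument [x / m] eventually lies where the sine has the sign of its argument
    and at least half its size, so the two bounds squeeze the step. The value 1 at 0 makes the limit
    the indicator of the closed half-line. *)
Lemma cvg_smooth_step x : smooth_step m x @[m --> \oo] --> ((0 <= x)%R%:R : R).
Proof.
have [d d0 hd] := sin_ge_half_near0.
have small : \forall m \near \oo, 0 <= `|m%:R^-1 * x| <= d.
  near=> m; rewrite normr_ge0/= normrM ger0_norm ?invr_ge0//.
  rewrite mulrC ler_pdivrMr; last by rewrite ltr0n; near: m; exact: nbhs_infty_gt.
  by rewrite mulrC -ler_pdivrMr//; near: m; exact: nbhs_infty_ger.
have [x0|x0] := leP 0 x.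
  apply: (@squeeze_cvgr _ _ _ _ (fun m => 1 - (1 + m%:R)^-1) (cst 1)).
  - near=> m; apply/andP; split; last by have /andP[] := smooth_step_itv m x.
    apply: smooth_step_ge.
    have /hd : 0 <= `|m%:R^-1 * x| <= d by near: m.
    rewrite ger0_norm; last by rewrite mulr_ge0// invr_ge0.
    by apply: le_trans; rewrite mulr_ge0// mulr_ge0// invr_ge0.
  - rewrite -[X in _ --> X]subr0; apply: cvgB; first exact: cvg_cst.
    have := @cvg_harmonic R; apply: cvg_trans; apply: near_eq_cvg.
    by near=> m; rewrite /= nat1r.
  - exact: cvg_cst.
(* The upper bound is that of [smooth_step_le] with the sine replaced by half its argument. *)
apply: (@squeeze_cvgr _ _ _ _ (cst 0) (fun m => 2 / - x * m%:R^-1)).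
- near=> m; apply/andP; split; first by have /andP[] := smooth_step_itv m x.
  have m0 : (0 < m)%N by near: m; exact: nbhs_infty_gt.
  have mr0 : 0 < (m%:R : R) by rewrite ltr0n.
  have im0 : 0 < (m%:R : R)^-1 by rewrite invr_gt0.
  have /hd : 0 <= `|m%:R^-1 * x| <= d by near: m.
  rewrite ler0_norm; last by nra.
  rewrite sinN => h.
  have h0 : 0 < - sin (m%:R^-1 * x) by apply: lt_le_trans h; nra.
  apply: (le_trans (smooth_step_le m0 h0)).
  have -> : 2 / - x * m%:R^-1 = (m%:R ^+ 2 * (- (m%:R^-1 * x) / 2))^-1.
    by field; rewrite lt0r_neq0//= ltr0_neq0.
  rewrite lef_pV2 ?posrE ?mulr_gt0 ?exprn_gt0//; last by nra.
  by rewrite ler_pM2l ?exprn_gt0.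
- exact: cvg_cst.
- rewrite -[X in _ --> X](mulr0 (2 / - x)); apply: cvgM; first exact: cvg_cst.
  apply/gtr0_cvgV0; last exact: cvgr_idn.
  by near=> m; rewrite ltr0n; near: m; exact: nbhs_infty_gt.
Unshelve. all: by end_near. Qed.

End step_approximation.

(** * Real trigonometric polynomials in two variables *)

Section trigonometric_polynomials.
Context {R : realType}.

(** Phases make sines and constants special cases of cosines. Products are derived rather than
    generated, so that an induction only meets cosines of a single projection and linear
    combinations. *)
Inductive trigpoly : (R -> R -> R) -> Prop :=
| trigpoly_cos s t phi : trigpoly (fun x y => cos (s * x + t * y + phi))
| trigpolyD F G : trigpoly F -> trigpoly G -> trigpoly (fun x y => F x y + G x y)
| trigpolyZ k F : trigpoly F -> trigpoly (fun x y => k * F x y).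

Lemma eq_trigpoly F G : trigpoly F -> (forall x y, F x y = G x y) -> trigpoly G.
Proof. by move=> hF FG; rewrite (_ : G = F)//; do 2 apply/funext => ?. Qed.

(** The product-to-sum formula for two cosines, extended bilinearly. *)
Lemma trigpolyM F G :
  trigpoly F -> trigpoly G -> trigpoly (fun x y => F x y * G x y).
Proof.
move=> hF hG; elim: hF => [s t phi|F1 F2 _ IH1 _ IH2|k F1 _ IH1].
- elim: hG => [s' t' phi'|G1 G2 _ IH1 _ IH2|k G1 _ IH1].
  + apply: (eq_trigpoly (trigpolyZ (1 / 2) (trigpolyD
      (trigpoly_cos (s + s') (t + t') (phi + phi'))
      (trigpoly_cos (s - s') (t - t') (phi - phi'))))) => x y.
    set a := s * x + t * y + phi; set b := s' * x + t' * y + phi'.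
    rewrite (_ : (s + s') * x + _ + _ = a + b); last by rewrite /a /b; ring.
    rewrite (_ : (s - s') * x + _ + _ = a - b); last by rewrite /a /b; ring.
    by rewrite cosD cosB; field.
  + by apply: (eq_trigpoly (trigpolyD IH1 IH2)) => x y; rewrite mulrDr.
  + by apply: (eq_trigpoly (trigpolyZ k IH1)) => x y; rewrite mulrCA.
- by apply: (eq_trigpoly (trigpolyD IH1 IH2)) => x y; rewrite mulrDl.
- by apply: (eq_trigpoly (trigpolyZ k IH1)) => x y; rewrite mulrA.
Qed.

Lemma trigpoly_cst k : trigpoly (fun _ _ => k).
Proof.
apply: (eq_trigpoly (trigpolyZ k (trigpoly_cos 0 0 0))) => x y.
by rewrite !mul0r !addr0 cos0 mulr1.
Qed.

Lemma trigpolyX F n : trigpoly F -> trigpoly (fun x y => F x y ^+ n).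
Proof.
move=> hF; elim: n => [|n IH].
  by apply: (eq_trigpoly (trigpoly_cst 1)) => x y; rewrite expr0.
by apply: (eq_trigpoly (trigpolyM hF IH)) => x y; rewrite exprS.
Qed.

Lemma trigpoly_onem F : trigpoly F -> trigpoly (fun x y => 1 - F x y).
Proof.
move=> hF; apply: (eq_trigpoly (trigpolyD (trigpoly_cst 1) (trigpolyZ (-1) hF))).
by move=> x y; rewrite mulN1r.
Qed.

Lemma trigpoly_sin s t : trigpoly (fun x y => sin (s * x + t * y)).
Proof.
apply: (eq_trigpoly (trigpolyZ (-1) (trigpoly_cos s t (pi / 2)))) => x y.
by rewrite cosDpihalf mulN1r opprK.
Qed.

Lemma trigpoly_smooth_step m (a b : R) :
  trigpoly (fun x y => smooth_step m (a * x + b * y)).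
Proof.
apply: trigpoly_onem; apply: trigpolyX; apply: trigpoly_onem; apply: trigpolyX.
apply: (eq_trigpoly (trigpolyZ (1 / 2) (trigpolyD (trigpoly_cst 1)
  (trigpoly_sin (m%:R^-1 * a) (m%:R^-1 * b))))) => x y.
by rewrite div1r [in RHS]mulrC [m%:R^-1 * (_ + _)]mulrDr !mulrA.
Qed.

End trigonometric_polynomials.

(** * Quadrant probabilities from the laws of projections *)

Section orthant_probability.
Context {R : realType}.

Lemma measurable_half_space (d : measure_display) (T : measurableType d)
  (U V : T -> R) : measurable_fun setT U -> measurable_fun setT V ->
  measurable [set w | U w <= V w].
Proof.
by move=> mU mV; rewrite -[X in measurable X]setTI; exact: measurable_fun_le.
Qed.

Lemma measurable_cos_linear (d : measure_display) (T : measurableType d)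
  (U V : T -> R) s t phi : measurable_fun setT U -> measurable_fun setT V ->
  measurable_fun setT (fun w => cos (s * U w + t * V w + phi)).
Proof.
move=> mU mV; apply: measurableT_comp.
  by apply: continuous_measurable_fun; exact: continuous_cos.
apply: measurable_funD => //; apply: measurable_funD => //;
  exact: measurable_funM.
Qed.

Lemma trigpoly_integrable (d : measure_display) (T : measurableType d)
  (P : probability T R) (U V : T -> R) F :
  measurable_fun setT U -> measurable_fun setT V -> trigpoly F ->
  P.-integrable setT (EFin \o (fun w => F (U w) (V w))).
Proof.
move=> mU mV; elim=> [s t phi|F1 F2 _ IH1 _ IH2|k F1 _ IH1].
- apply: measurable_bounded_integrable => //=.
  + by rewrite (le_lt_trans (probability_le1 _ _)) ?ltry.
  + exact: measurable_cos_linear.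
  + exists 1; split => // M M1 w _ /=.
    by rewrite (le_trans (cos_max _))// ltW.
- exact: (integrableD measurableT IH1 IH2).
- exact: (integrableZl measurableT k IH1).
Qed.

(** Both sides integrate one bounded function against the image measures, which coincide. *)
Lemma eq_law_integral_cos (d : measure_display) (T : measurableType d)
  (P : probability T R) (d' : measure_display) (T' : measurableType d')
  (P' : probability T' R) (Y : T -> R) (Y' : T' -> R) phi :
  measurable_fun setT Y -> measurable_fun setT Y' ->
  (forall A, measurable A -> P (Y @^-1` A) = P' (Y' @^-1` A)) ->
  (\int[P]_w (cos (Y w + phi))%:E = \int[P']_w (cos (Y' w + phi))%:E)%E.
Proof.
move=> mY mY' YY'.
pose rY : {mfun T >-> R} := HB.pack Y (isMeasurableFun.Build _ _ _ _ _ mY).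
pose rY' : {mfun T' >-> R} := HB.pack Y' (isMeasurableFun.Build _ _ _ _ _ mY').
pose f (x : R) := (cos (x + phi))%:E.
have mf : measurable_fun setT f.
  apply/measurable_EFinP; apply: measurableT_comp.
    by apply: continuous_measurable_fun; exact: continuous_cos.
  exact: measurable_funD.
have If (dd : measure_display) (TT : measurableType dd) (Q : probability TT R)
  (Z : {mfun TT >-> R}) : Q.-integrable setT (f \o Z).
  have := trigpoly_integrable Q (measurable_funP Z) (measurable_funP Z)
    (trigpoly_cos 1 0 phi).
  apply: eq_integrable => // w _ /=.
  by rewrite /f mul1r mul0r addr0.
rewrite -[LHS](@integral_distribution _ _ _ _ _ P rY f)//.
rewrite -[RHS](@integral_distribution _ _ _ _ _ P' rY' f)//.
by apply: eq_measure_integral => A mA _; exact: YY'.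
Qed.

Section two_pairs.
Context (d : measure_display) (T : measurableType d) (P : probability T R)
  (d' : measure_display) (T' : measurableType d') (P' : probability T' R).
Context (U V : T -> R) (U' V' : T' -> R).
Hypotheses (mU : measurable_fun setT U) (mV : measurable_fun setT V).
Hypotheses (mU' : measurable_fun setT U') (mV' : measurable_fun setT V').
Hypothesis eq_law : forall s t A, measurable A ->
  P ((fun w => s * U w + t * V w) @^-1` A) =
  P' ((fun w => s * U' w + t * V' w) @^-1` A).

(** The hypothesis on laws enters only for a single cosine; linearity of the integral does the
    rest. *)
Lemma eq_law_trigpoly F : trigpoly F ->
  (\int[P]_w (F (U w) (V w))%:E = \int[P']_w (F (U' w) (V' w))%:E)%E.
Proof.
elim=> [s t phi|F1 F2 h1 IH1 h2 IH2|k F1 h1 IH1].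
- apply: eq_law_integral_cos; last by move=> A; exact: eq_law.
  + by apply: measurable_funD => //; exact: measurable_funM.
  + by apply: measurable_funD => //; exact: measurable_funM.
- have := trigpoly_integrable P mU mV h1; have := trigpoly_integrable P mU mV h2.
  have := trigpoly_integrable P' mU' mV' h1; have := trigpoly_integrable P' mU' mV' h2.
  move=> i1 i2 i3 i4.
  under eq_integral do rewrite EFinD.
  under [RHS]eq_integral do rewrite EFinD.
  by rewrite !integralD// IH1 IH2.
- have := trigpoly_integrable P mU mV h1; have := trigpoly_integrable P' mU' mV' h1.
  move=> i1 i2.
  under eq_integral do rewrite EFinM.
  under [RHS]eq_integral do rewrite EFinM.
  by rewrite !integralZl// IH1.
Qed.

End two_pairs.

(** Dominated convergence with bound 1: the product of two steps tends pointwise to the indicator of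
    the closed quadrant. The coefficients 1 and 0 give both factors the shape required by
    [trigpoly_smooth_step]. *)
Lemma cvg_trigpoly_orthant (d : measure_display) (T : measurableType d)
  (P : probability T R) (U V : T -> R) :
  measurable_fun setT U -> measurable_fun setT V ->
  (\int[P]_w (smooth_step m (1 * U w + 0 * V w) *
    smooth_step m (0 * U w + 1 * V w))%:E)%E @[m --> \oo] -->
  P [set w | 0 <= U w /\ 0 <= V w].
Proof.
move=> mU mV.
have mO : measurable [set w | 0 <= U w /\ 0 <= V w].
  rewrite (_ : [set _ | _] = [set w | 0 <= U w] `&` [set w | 0 <= V w])//.
  by apply: measurableI; apply: measurable_half_space.
rewrite -(setIT [set w | 0 <= U w /\ 0 <= V w]) -integral_indic//.
apply: (@dominated_cvg _ _ _ P setT measurableT _ _ (cst 1%E)) => //=.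
- move=> m; apply/measurable_EFinP.
  have /integrableP[/measurable_EFinP] := trigpoly_integrable P mU mV
    (trigpolyM (trigpoly_smooth_step m 1 0) (trigpoly_smooth_step m 0 1)).
  by [].
- move=> w _; apply/cvg_EFin; first by apply: nearW.
  rewrite (_ : \1_ _ _ = (0 <= U w)%R%:R * (0 <= V w)%R%:R); last first.
    rewrite indicE/= -natrM mulnb; congr (_%:R).
    by congr nat_of_bool; apply/idP/andP; rewrite in_setE.
  rewrite !(mul1r, mul0r, addr0, add0r).
  by apply: cvgM; exact: cvg_smooth_step.
- exact: finite_measure_integrable_cst.
- move=> m w _; rewrite lee_fin.
  have /andP[a0 a1] := smooth_step_itv m (1 * U w + 0 * V w).
  have /andP[b0 b1] := smooth_step_itv m (0 * U w + 1 * V w).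
  by rewrite ger0_norm ?mulr_ge0// mulr_ile1.
Qed.

(* The Cramer--Wold theorem, tested on a quadrant. *)
Lemma eq_law_orthant (d : measure_display) (T : measurableType d)
  (P : probability T R) (d' : measure_display) (T' : measurableType d')
  (P' : probability T' R) (U V : T -> R) (U' V' : T' -> R) :
  measurable_fun setT U -> measurable_fun setT V ->
  measurable_fun setT U' -> measurable_fun setT V' ->
  (forall s t A, measurable A ->
    P ((fun w => s * U w + t * V w) @^-1` A) =
    P' ((fun w => s * U' w + t * V' w) @^-1` A)) ->
  P [set w | 0 <= U w /\ 0 <= V w] = P' [set w | 0 <= U' w /\ 0 <= V' w].
Proof.
move=> mU mV mU' mV' eq_law.
pose F m x y : R := smooth_step m (1 * x + 0 * y) * smooth_step m (0 * x + 1 * y).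
have h : (\int[P]_w (F m (U w) (V w))%:E)%E @[m --> \oo] -->
  P [set w | 0 <= U w /\ 0 <= V w] by exact: cvg_trigpoly_orthant.
have h' : (\int[P']_w (F m (U' w) (V' w))%:E)%E @[m --> \oo] -->
  P' [set w | 0 <= U' w /\ 0 <= V' w] by exact: cvg_trigpoly_orthant.
have E : (fun m => \int[P]_w (F m (U w) (V w))%:E)%E =
  (fun m => \int[P']_w (F m (U' w) (V' w))%:E)%E.
  apply/funext => m; apply: eq_law_trigpoly => //.
  by apply: trigpolyM; exact: trigpoly_smooth_step.
rewrite E in h.
by rewrite -(cvg_lim (@ereal_hausdorff R) h) -(cvg_lim (@ereal_hausdorff R) h').
Qed.

End orthant_probability.

(** * The Gaussian law on the line: shifts and positivity *)

Section gaussian_law.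
Context {R : realType}.
Implicit Types (m v k : R).

(** Lebesgue measure is determined by half-open intervals, whose lengths a shift preserves. *)
Lemma lebesgue_measure_shift (k : R) (A : set R) : measurable A ->
  pushforward lebesgue_measure (fun x : measurableTypeR R => x + k : measurableTypeR R) A
  = lebesgue_measure A.
Proof.
move=> mA.
have mk : measurable_fun setT (fun x : measurableTypeR R => x + k : measurableTypeR R).
  exact: measurable_funD.
pose rk : {mfun measurableTypeR R >-> measurableTypeR R} :=
  HB.pack (fun x : measurableTypeR R => x + k : measurableTypeR R)
    (isMeasurableFun.Build _ _ _ _ _ mk).
apply/esym/(@lebesgue_measure_unique R (pushforward lebesgue_measure rk)) => //= _ [[a b]] _ <-.
rewrite /pushforward/=.
rewrite (_ : _ @^-1` _ = `](a - k), (b - k)]%classic); last first.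
  by apply/seteqP; split => x /=; rewrite !in_itv/=; lra.
rewrite !lebesgue_measure_itv/= !lte_fin ltrD2r.
by case: ifP => // _; rewrite -!EFinB; congr (_%:E); ring.
Qed.

Lemma normal_pdf_shift m s k x : s != 0 -> normal_pdf m s x = normal_pdf (m + k) s (x + k).
Proof.
move=> s0; rewrite !normal_pdfE// /normal_fun.
by rewrite (_ : x + k - (m + k) = x - m)//; ring.
Qed.

Lemma gauss_law_shift m v k (A : set R) : 0 <= v -> measurable A ->
  gauss_law m v ((fun x => x + k) @^-1` A) = gauss_law (m + k) v A.
Proof.
move=> v0 mA; rewrite /gauss_law; case: ifPn => [_|vn0]; first by rewrite !diracE.
have s0 : Num.sqrt v != 0 by rewrite sqrtr_eq0 -ltNge lt_neqAle eq_sym vn0.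
have mk : measurable_fun setT (fun x : measurableTypeR R => x + k : measurableTypeR R).
  exact: measurable_funD.
pose rk : {mfun measurableTypeR R >-> measurableTypeR R} :=
  HB.pack (fun x : measurableTypeR R => x + k : measurableTypeR R)
    (isMeasurableFun.Build _ _ _ _ _ mk).
rewrite /normal_prob.
transitivity (\int[pushforward lebesgue_measure rk]_(x in A)
  (normal_pdf (m + k) (Num.sqrt v) x)%:E)%E.
  rewrite ge0_integral_pushforward//.
  - by apply: eq_integral => x _ /=; rewrite (normal_pdf_shift _ k).
  - by apply/measurable_EFinP/measurable_funTS; exact: measurable_normal_pdf.
  - by move=> x _; rewrite lee_fin normal_pdf_ge0.
by apply: eq_measure_integral => B mB _; exact: lebesgue_measure_shift.
Qed.

(** The density is strictly positive; a zero integral would make it vanish almost everywhere on an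
    interval of positive length. *)
Lemma gauss_law_itv_gt0 m v (a b : R) :
  0 < v -> a < b -> (0 < gauss_law m v `[a, b[)%E.
Proof.
move=> v0 ab; rewrite /gauss_law gt_eqF//.
have s0 : Num.sqrt v != 0 by rewrite gt_eqF// sqrtr_gt0.
rewrite lt0e measure_ge0 andbT; apply/eqP => n0.
have pdf_gt0 x : 0 < normal_pdf m (Num.sqrt v) x.
  by rewrite normal_pdfE// mulr_gt0 ?expR_gt0 ?normal_peak_gt0.
have mpdf : measurable_fun `[a, b[ (fun x => (normal_pdf m (Num.sqrt v) x)%:E).
  by apply/measurable_EFinP/measurable_funTS; exact: measurable_normal_pdf.
have := (ae_eq_integral_abs lebesgue_measure (measurable_itv `[a, b[) mpdf).1.
under eq_integral do rewrite gee0_abs ?lee_fin ?normal_pdf_ge0//.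
move=> /(_ n0) [N [mN N0 sN]].
have : (lebesgue_measure `[a, b[%classic <= lebesgue_measure N)%E.
  apply: le_measure; rewrite ?inE// => x xab; apply: sN => /= /(_ xab).
  by move/eqP; rewrite eqe gt_eqF.
by rewrite N0 lebesgue_measure_itv/= lte_fin ab -EFinB lee_fin subr_le0 leNgt ab.
Qed.

Lemma gauss_law_set1 m v (a : R) : 0 < v -> gauss_law m v [set a] = 0%E.
Proof. by move=> v0; rewrite /gauss_law gt_eqF// /normal_prob integral_set1. Qed.

Lemma gauss_lawU m v (A B : set R) : 0 < v -> measurable A -> measurable B ->
  A `&` B = set0 -> gauss_law m v (A `|` B) = (gauss_law m v A + gauss_law m v B)%E.
Proof. by move=> v0 mA mB AB; rewrite /gauss_law gt_eqF// measureU. Qed.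

Lemma gauss_law_fin_num m v (A : set R) :
  0 < v -> measurable A -> gauss_law m v A \is a fin_num.
Proof. by move=> v0 mA; rewrite /gauss_law gt_eqF// fin_num_measure. Qed.

End gaussian_law.

(* Unification is otherwise tempted to unfold the normal density. *)
#[local] Opaque gauss_law.

(** * Gaussian pairs and affine changes of coordinates *)

Section gaussian_pair.
Context {R : realType}.

(* [(U, V)] is Gaussian with means [m1], [m2] and covariance matrix
   [[a, b], [b, c]]. *)
Definition gauss_pair (d : measure_display) (T : measurableType d)
  (P : probability T R) (U V : T -> R) (m1 m2 a b c : R) : Prop :=
  [/\ measurable_fun setT U, measurable_fun setT V,
    forall s t, 0 <= s ^+ 2 * a + 2 * s * t * b + t ^+ 2 * c &
    forall s t A, measurable A ->
      P ((fun w => s * U w + t * V w) @^-1` A) =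
      gauss_law (s * m1 + t * m2) (s ^+ 2 * a + 2 * s * t * b + t ^+ 2 * c) A].

Section one_pair.
Context (d : measure_display) (T : measurableType d) (P : probability T R).
Context (U V : T -> R).

(** A projection of the new pair is a projection of the old one with coefficients [s * p + t * p']
    and [s * q + t * q'], plus a constant absorbed by [gauss_law_shift]. *)
Lemma gauss_pair_affine (m1 m2 a b c p q e p' q' e' : R) :
  gauss_pair P U V m1 m2 a b c ->
  gauss_pair P (fun w => p * U w + q * V w + e) (fun w => p' * U w + q' * V w + e')
    (p * m1 + q * m2 + e) (p' * m1 + q' * m2 + e')
    (p ^+ 2 * a + 2 * p * q * b + q ^+ 2 * c)
    (p * p' * a + (p * q' + p' * q) * b + q * q' * c)
    (p' ^+ 2 * a + 2 * p' * q' * b + q' ^+ 2 * c).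
Proof.
move=> [mU mV v0 law].
have mlin (x y z : R) : measurable_fun setT (fun w => x * U w + y * V w + z).
  by apply: measurable_funD => //; apply: measurable_funD => //;
     exact: measurable_funM.
split; [exact: mlin|exact: mlin| |].
  move=> s t; pose S := s * p + t * p'; pose W := s * q + t * q'.
  rewrite [leRHS](_ : _ = S ^+ 2 * a + 2 * S * W * b + W ^+ 2 * c) ?v0//.
  by rewrite /S /W; ring.
move=> s t A mA.
rewrite (_ : _ @^-1` A = (fun w => (s * p + t * p') * U w + (s * q + t * q') * V w)
    @^-1` ((fun x => x + (s * e + t * e')) @^-1` A)); last first.
  by apply/seteqP; split => w /=; congr A; ring.
rewrite law; last first.
  rewrite -[X in measurable X]setTI.
  by apply: (measurable_funD (f := id)) => //; exact: measurable_cst.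
rewrite (gauss_law_shift _ _ (v0 _ _) mA).
set v := (X in gauss_law _ X A); set v' := (X in _ = gauss_law _ X A).
set m := (X in gauss_law X v A); set m' := (X in _ = gauss_law X v' A).
have -> : v = v' by rewrite /v /v'; ring.
by have -> : m = m' by rewrite /m /m'; ring.
Qed.

Lemma gauss_pair_halfplane (m1 m2 a b c s t e : R) :
  gauss_pair P U V m1 m2 a b c ->
  P [set w | e <= s * U w + t * V w] =
  gauss_law (s * m1 + t * m2) (s ^+ 2 * a + 2 * s * t * b + t ^+ 2 * c) `[e, +oo[.
Proof.
move=> [mU mV v0 law]; rewrite -law//; congr (P _).
by apply/seteqP; split => w /=; rewrite in_itv/= andbT.
Qed.

End one_pair.

(** The five parameters fix the laws of all projections, so a pair may be traded for another one,
    even on a different space. *)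
Lemma gauss_pair_orthant (d : measure_display) (T : measurableType d)
  (P : probability T R) (d' : measure_display) (T' : measurableType d')
  (P' : probability T' R) (U V : T -> R) (U' V' : T' -> R) (m1 m2 a b c : R) :
  gauss_pair P U V m1 m2 a b c -> gauss_pair P' U' V' m1 m2 a b c ->
  P [set w | 0 <= U w /\ 0 <= V w] = P' [set w | 0 <= U' w /\ 0 <= V' w].
Proof.
move=> [mU mV v0 law] [mU' mV' v0' law'].
by apply: eq_law_orthant => // s t A mA; rewrite law// law'.
Qed.

(** * Rotation invariance and positive mass of cones *)

Section standard_pair.
Context (d : measure_display) (T : measurableType d) (P : probability T R).
Context (U V : T -> R).
Hypothesis std : gauss_pair P U V 0 0 1 0 1.

Lemma gauss_pair_rotation (x y : R) : x ^+ 2 + y ^+ 2 = 1 ->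
  gauss_pair P (fun w => x * U w + y * V w) (fun w => - y * U w + x * V w) 0 0 1 0 1.
Proof.
move=> xy1; have := gauss_pair_affine x y 0 (- y) x 0 std.
rewrite (_ : (fun w => _ + 0) = (fun w => x * U w + y * V w)); last first.
  by apply/funext => w; rewrite addr0.
rewrite (_ : (fun w => _ + 0) = (fun w => - y * U w + x * V w)); last first.
  by apply/funext => w; rewrite addr0.
rewrite !mulr0 !addr0 !mulr1 sqrrN [y ^+ 2 + _]addrC xy1.
by rewrite (_ : x * - y + y * x = 0)//; ring.
Qed.

End standard_pair.

(** Both events are quadrants for the same affine map, applied to the pair and to its rotation; the
    resulting pairs have equal parameters. *)
Lemma gauss_pair_cone_rotation (d : measure_display) (T : measurableType d)
  (P : probability T R) (U V : T -> R) (x y p q e p' q' e' : R) :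
  gauss_pair P U V 0 0 1 0 1 -> x ^+ 2 + y ^+ 2 = 1 ->
  P [set w | e <= p * U w + q * V w /\ e' <= p' * U w + q' * V w] =
  P [set w | e <= p * (x * U w + y * V w) + q * (- y * U w + x * V w) /\
             e' <= p' * (x * U w + y * V w) + q' * (- y * U w + x * V w)].
Proof.
move=> std xy1.
have h := gauss_pair_affine p q (- e) p' q' (- e') std.
have h' := gauss_pair_affine p q (- e) p' q' (- e') (gauss_pair_rotation std xy1).
have := gauss_pair_orthant h h'.
rewrite (_ : [set w | 0 <= _ + - e /\ _] =
  [set w | e <= p * U w + q * V w /\ e' <= p' * U w + q' * V w]); last first.
  by apply/seteqP; split => w /=; rewrite !subr_ge0.
move=> ->; congr (P _).
by apply/seteqP; split => w /=; rewrite !subr_ge0.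
Qed.

(** Rotations are parametrized by the slope [q], these being the cosine and sine of its arctangent,
    so that the rationals index a countable dense family. *)
Lemma rotation_coef (q : R) :
  (Num.sqrt (1 + q ^+ 2))^-1 ^+ 2 + (q / Num.sqrt (1 + q ^+ 2)) ^+ 2 = 1.
Proof.
have h : 0 < 1 + q ^+ 2 by have := sqr_ge0 q; lra.
rewrite exprMn exprVn sqr_sqrtr; last exact: ltW.
by field; rewrite gt_eqF.
Qed.

Lemma cvg_rotated_form (u v k q0 : R) :
  ((Num.sqrt (1 + q ^+ 2))^-1 * u + q / Num.sqrt (1 + q ^+ 2) * v) +
  k * (- (q / Num.sqrt (1 + q ^+ 2)) * u + (Num.sqrt (1 + q ^+ 2))^-1 * v)
  @[q --> q0] -->
  ((Num.sqrt (1 + q0 ^+ 2))^-1 * u + q0 / Num.sqrt (1 + q0 ^+ 2) * v) +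
  k * (- (q0 / Num.sqrt (1 + q0 ^+ 2)) * u + (Num.sqrt (1 + q0 ^+ 2))^-1 * v).
Proof.
have s0 : Num.sqrt (1 + q0 ^+ 2) != 0.
  by rewrite gt_eqF// sqrtr_gt0; have := sqr_ge0 q0; lra.
have cinv : (Num.sqrt (1 + q ^+ 2))^-1 @[q --> q0] --> (Num.sqrt (1 + q0 ^+ 2))^-1.
  apply: cvgV => //; apply: (cvg_comp (fun q : R => 1 + q ^+ 2) Num.sqrt).
    by apply: cvgD; [exact: cvg_cst|exact: sqr_continuous].
  exact: sqrt_continuous.
have cq : q / Num.sqrt (1 + q ^+ 2) @[q --> q0] --> q0 / Num.sqrt (1 + q0 ^+ 2).
  by apply: cvgM cinv; exact: cvg_id.
apply: cvgD; first by apply: cvgD; apply: cvgM => //; exact: cvg_cst.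
apply: cvgM; first exact: cvg_cst.
by apply: cvgD; apply: cvgM => //; [exact: cvgN|exact: cvg_cst|exact: cvg_cst].
Qed.

(** The rotation of slope [v / u] takes [(u, v)] to the positive first axis: the term in [k]
    vanishes and the rest is the norm of [(u, v)]. *)
Lemma rotated_form_at_slope (u v k : R) : 0 < u -> 
  ((Num.sqrt (1 + (v / u) ^+ 2))^-1 * u + v / u / Num.sqrt (1 + (v / u) ^+ 2) * v) +
  k * (- (v / u / Num.sqrt (1 + (v / u) ^+ 2)) * u + (Num.sqrt (1 + (v / u) ^+ 2))^-1 * v)
  >= u.
Proof.
move=> u0; set s := Num.sqrt _.
have s2 : s ^+ 2 = 1 + (v / u) ^+ 2 by rewrite sqr_sqrtr//; have := sqr_ge0 (v / u); lra.
have s0 : 0 <= s by exact: sqrtr_ge0.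
have s1 : 1 <= s by have := sqr_ge0 (v / u); nra.
rewrite [X in _ <= X](_ : _ = u * s ^+ 2 / s); last first.
  by rewrite s2; field; rewrite !gt_eqF//; lra.
by rewrite expr2 mulrA mulfK; [nra|rewrite gt_eqF//; lra].
Qed.

(* By rotation invariance all rotations of a null cone are null, and countably
   many of them cover the half-plane [U > |e| + |e'|]. *)
Lemma standard_cone_gt0 (d : measure_display) (T : measurableType d)
  (P : probability T R) (U V : T -> R) (k e k' e' : R) :
  gauss_pair P U V 0 0 1 0 1 ->
  (0 < P [set w | e <= 1 * U w + k * V w /\ e' <= 1 * U w + k' * V w]%R)%E.
Proof.
move=> std; have [mU mV _ law] := std.
rewrite lt0e measure_ge0 andbT; apply/eqP => P0.
pose x (q : R) := (Num.sqrt (1 + q ^+ 2))^-1.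
pose y (q : R) := q / Num.sqrt (1 + q ^+ 2).
pose N q := [set w | e <= 1 * (x q * U w + y q * V w) + k * (- y q * U w + x q * V w) /\
             e' <= 1 * (x q * U w + y q * V w) + k' * (- y q * U w + x q * V w)].
have ml s t : measurable_fun setT (fun w => s * U w + t * V w).
  by apply: measurable_funD; exact: measurable_funM.
have mN q : measurable (N q).
  rewrite (_ : N q = [set w | e <= 1 * (x q * U w + y q * V w) + k * (- y q * U w + x q * V w)] `&`
    [set w | e' <= 1 * (x q * U w + y q * V w) + k' * (- y q * U w + x q * V w)])//.
  by apply: measurableI; apply: measurable_half_space => //;
    apply: measurable_funD; apply: measurable_funM => //; exact: ml.
have N0 q : P (N q) = 0%E.
  by rewrite -P0; apply/esym/gauss_pair_cone_rotation => //; exact: rotation_coef.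
(* An enumeration of the rationals; numbers that code no rational give the slope 0. *)
pose rt n : R := ratr (odflt 0 (@unpickle rat n)).
have mB : measurable (\bigcup_n N (rt n)) by exact: bigcupT_measurable.
have /(negligibleP P mB) B0 : P.-negligible (\bigcup_n N (rt n)).
  by apply: negligible_bigcup => n; apply/(negligibleP P (mN _)); exact: N0.
(* On the strip [S], where [U] lies in [[M, M + 1[], [U] is positive and exceeds both thresholds;
   the strip has positive mass. *)
pose M := `|e| + `|e'| + 1.
pose S := (fun w => 1 * U w + 0 * V w) @^-1` `[M, M + 1[.
have sub : S `<=` \bigcup_n N (rt n).
  move=> w; rewrite /S/= in_itv/= mul1r mul0r addr0 => /andP[MU _].
  have u0 : 0 < U w.
    by apply: lt_le_trans MU; rewrite /M; have := normr_ge0 e; have := normr_ge0 e'; lra.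
  (* The inequality is strict at the slope [V w / U w], hence persists for nearby slopes, among them
     a rational one. *)
  have near_ge j f : f < U w ->
      \forall q \near (V w / U w), f < (x q * U w + y q * V w) + j * (- y q * U w + x q * V w).
    move=> fU; have /cvgr_gt := @cvg_rotated_form (U w) (V w) j (V w / U w).
    by apply; apply: (lt_le_trans fU); exact: rotated_form_at_slope.
  have /near_ge h1 : e < U w.
    by apply: lt_le_trans MU; rewrite /M; have := ler_norm e; have := normr_ge0 e'; lra.
  have /near_ge h2 : e' < U w.
    by apply: lt_le_trans MU; rewrite /M; have := ler_norm e'; have := normr_ge0 e; lra.
  have /nbhs_ballP[r /= r0 hr] : \forall q \near (V w / U w),
      e < (x q * U w + y q * V w) + k * (- y q * U w + x q * V w) /\
      e' < (x q * U w + y q * V w) + k' * (- y q * U w + x q * V w).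
    exact: filterI (h1 k) (h2 k').
  have /rat_in_itvoo[q] : V w / U w - r < V w / U w + r by lra.
  rewrite in_itv/= => qr.
  exists (pickle q) => //; rewrite /N /rt pickleK/=.
  have [|g1 g2] := hr (ratr q).
    by rewrite /ball/= ltr_norml; lra.
  by rewrite !mul1r !ltW.
have mS : measurable S.
  by rewrite -[X in measurable X]setTI; exact: ml.
have : (P S <= 0)%E.
  by rewrite -B0; apply: le_measure => //; exact: mem_set.
rewrite /S law// leNgt gauss_law_itv_gt0//; lra.
Qed.

Lemma gauss_pair_cone_gt0 (d : measure_display) (T : measurableType d)
  (P : probability T R) (U V : T -> R) (a b e a' b' e' : R) :
  gauss_pair P U V 0 0 1 0 1 -> a * b' - a' * b != 0 ->
  (0 < P [set w | e <= a * U w + b * V w /\ e' <= a' * U w + b' * V w]%R)%E.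
Proof.
move=> std D0.
(* [(x, y)] solves [a x + b y = a' x + b' y = 1]; rotating it onto the first
   axis brings both forms to the shape [1 * U + k * V] up to scaling. *)
pose D := a * b' - a' * b; pose x := (b' - b) / D; pose y := (a - a') / D.
have E1 : a * x + b * y = 1 by rewrite /x /y /D; field.
have E2 : a' * x + b' * y = 1 by rewrite /x /y /D; field.
move: x y E1 E2 => x y E1 E2.
have r20 : 0 < x ^+ 2 + y ^+ 2.
  rewrite lt0r addr_ge0 ?sqr_ge0// andbT paddr_eq0 ?sqr_ge0// !sqrf_eq0.
  by apply/negP => /andP[/eqP x0 /eqP y0]; move: E1; rewrite x0 y0 !mulr0; lra.
pose r := Num.sqrt (x ^+ 2 + y ^+ 2).
have r0 : 0 < r by rewrite sqrtr_gt0.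
have r2 : r ^+ 2 = x ^+ 2 + y ^+ 2 by rewrite sqr_sqrtr// ltW.
have rn0 : r != 0 by rewrite gt_eqF.
rewrite (gauss_pair_cone_rotation (x := x / r) (y := - (y / r)) _ _ _ _ _ _ std); last first.
  by rewrite sqrrN !exprMn -mulrDl -r2 -exprMn divff// expr1n.
have := standard_cone_gt0 (b * x - a * y) (e * r) (b' * x - a' * y) (e' * r) std.
congr (0 < P _)%E; apply/seteqP.
(* The rotated form is [1 / r] times a form with first coefficient [p * x + q * y], which is 1. *)
have F (p q f : R) w : p * x + q * y = 1 ->
  (f <= p * (x / r * U w + - (y / r) * V w) + q * (- - (y / r) * U w + x / r * V w)) =
  (f * r <= 1 * U w + (q * x - p * y) * V w).
  move=> pq; rewrite -ler_pdivlMr//; congr (_ <= _).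
  by rewrite -pq; field.
by split => w /=; rewrite !F.
Qed.

End gaussian_pair.

(** * The quadrant probability determines the correlation *)

Section monotonicity.
Context {R : realType}.

Section measure_facts.
Context (d : measure_display) (T : measurableType d) (P : probability T R).

Lemma eq_probability_setD0 (A B C : set T) : measurable A -> measurable B ->
  measurable C -> A `<=` B -> P A = P B -> C `<=` B `\` A -> P C = 0%E.
Proof.
move=> mA mB mC AB PAB CBA.
have mBA : measurable (B `\` A) by exact: measurableD.
apply: (subset_measure0 mC mBA CBA).
rewrite measureD//; last by rewrite -ge0_fin_numE// fin_num_measure.
by rewrite (setIidr AB)/= PAB subee// fin_num_measure.
Qed.

Lemma eq_probability_setD (A B C : set T) : measurable A -> measurable B ->
  measurable C -> P A = P B -> P (A `&` C) = P (B `&` C) ->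
  P (A `\` C) = P (B `\` C).
Proof.
move=> mA mB mC PAB PI.
by rewrite !measureD -?ge0_fin_numE ?fin_num_measure//= PAB PI.
Qed.

(* Two half-planes of equal mass whose boundary lines cross have their
   difference in two opposite sectors; cutting along [U = - c1] leaves one of
   the sectors, up to a bounded part, on one side. *)
Lemma crossing_halfplanes_neq (U V : T -> R) (c1 s k s' k' : R) :
  gauss_pair P U V 0 0 1 0 1 -> s < s' ->
  P [set w | 0 <= s * U w + V w + k] = P [set w | 0 <= s' * U w + V w + k'] ->
  P [set w | 0 <= U w + c1 /\ 0 <= s * U w + V w + k] <>
  P [set w | 0 <= U w + c1 /\ 0 <= s' * U w + V w + k'].
Proof.
move=> std ss' PH PO; have [mU mV _ _] := std.
pose G := [set w | 0 <= U w + c1].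
pose H := [set w | 0 <= s * U w + V w + k].
pose H' := [set w | 0 <= s' * U w + V w + k'].
have mlin (a b : R) : measurable_fun setT (fun w => a * U w + V w + b).
  by apply: measurable_funD => //; apply: measurable_funD => //;
     exact: measurable_funM.
have mG : measurable G.
  by apply: measurable_half_space => //; exact: measurable_funD.
have mH : measurable H by apply: measurable_half_space.
have mH' : measurable H' by apply: measurable_half_space.
have mcone (a b e a' b' e' : R) :
    measurable [set w | e <= a * U w + b * V w /\ e' <= a' * U w + b' * V w].
  apply: (measurableI [set w | e <= a * U w + b * V w]
     [set w | e' <= a' * U w + b' * V w]);
  by apply: measurable_half_space => //; apply: measurable_funD; exact: measurable_funM.
have PGH : P (H `&` G) = P (H' `&` G) by rewrite ![_ `&` G]setIC.
(* Large enough that the cones below lie beyond the cut [U = - c1]; the extra 1 keeps them strictly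
   outside the smaller half-plane. *)
pose K := `|k| + `|k'| + `|(s' - s) * c1| + 1.
have := ler_norm k; have := ler_norm (- k).
have := ler_norm k'; have := ler_norm (- k').
have := ler_norm ((s' - s) * c1); have := ler_norm (- ((s' - s) * c1)).
rewrite !normrN -/K => n1 n2 n3 n4 n5 n6.
(* The boundary lines cross at abscissa [(k - k') / (s' - s)]. If this is at or left of the cut,
   then right of the cut the first half-plane lies inside the second, and their null difference
   contains a cone. *)
have [cr|cr] := leP (k - k') ((s' - s) * - c1).
  have : P [set w | - k' <= s' * U w + 1 * V w /\ K <= - s * U w + -1 * V w] = 0%E.
    apply: (@eq_probability_setD0 (H `&` G) (H' `&` G)) => //.
    - exact: measurableI.
    - exact: measurableI.
    - move=> w [h g]; split => //; move: h g; rewrite /H /G /H'/= => h g.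
      have : 0 <= (s' - s) * (U w + c1) by rewrite mulr_ge0 ?subr_ge0// ltW.
      by lra.
    - move=> w /= [w1 w2]; split.
        split; rewrite /H' /G/=; first lra.
        have : 0 <= (s' - s) * (U w + c1) by rewrite /K in w2; lra.
        by rewrite pmulr_rge0// subr_gt0.
      by move=> [+ _]; rewrite /H/= => h; rewrite /K in w2; lra.
  have := gauss_pair_cone_gt0 (- k') K (a := s') (b := 1) (a' := - s) (b' := -1) std.
  by move=> + C0; rewrite C0 ltxx => contra; suff : false by []; apply: contra; apply/eqP; lra.
(* If the crossing is right of the cut, the complement of [G] is used instead: there the inclusion
   is reversed, and the masses again agree. *)
have PD : P (H' `\` G) = P (H `\` G) by apply/esym/eq_probability_setD.
have : P [set w | - k <= s * U w + 1 * V w /\ K <= - s' * U w + -1 * V w] = 0%E.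
  apply: (@eq_probability_setD0 (H' `\` G) (H `\` G)) => //.
  - exact: measurableD.
  - exact: measurableD.
  - move=> w [h g]; split => //; move: h g; rewrite /H /G /H'/= => h.
    move=> /negP; rewrite -ltNge => g.
    have : (s' - s) * (U w + c1) <= 0 by rewrite pmulr_rle0 ?subr_gt0// ltW.
    by lra.
  - move=> w /= [w1 w2]; split.
      split; rewrite /H /G/=; first lra.
      apply/negP; rewrite -ltNge.
      have : 0 < (s' - s) * - (U w + c1) by rewrite /K in w2; lra.
      by rewrite pmulr_rgt0 ?subr_gt0// oppr_gt0.
    by move=> [+ _]; rewrite /H'/= => h; rewrite /K in w2; lra.
have := gauss_pair_cone_gt0 (- k) K (a := s) (b := 1) (a' := - s') (b' := -1) std.
by move=> + C0; rewrite C0 ltxx => contra; suff : false by []; apply: contra; apply/eqP; lra.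
Qed.

End measure_facts.

(** These are tangents of the arcsines of [r] and [r'], the slopes met in standardized coordinates.
    The signs decide which square root is larger. *)
Lemma slope_lt (r r' : R) : r ^+ 2 < 1 -> r' ^+ 2 < 1 -> r < r' ->
  r / Num.sqrt (1 - r ^+ 2) < r' / Num.sqrt (1 - r' ^+ 2).
Proof.
move=> r1 r1' rr'.
set t := Num.sqrt (1 - r ^+ 2); set t' := Num.sqrt (1 - r' ^+ 2).
have t0 : 0 < t by rewrite sqrtr_gt0 subr_gt0.
have t0' : 0 < t' by rewrite sqrtr_gt0 subr_gt0.
rewrite ltr_pdivrMr// mulrAC ltr_pdivlMr//.
have [r0|r0] := leP 0 r.
  have : t' <= t by apply: ler_wsqrtr; nra.
  by nra.
have [r0'|r0'] := leP r' 0; last by nra.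
have : t <= t' by apply: ler_wsqrtr; nra.
by nra.
Qed.

(** Both quadrants are realized over one standard pair [(X, Y)], by [(X + c1, q * X + u * Y + c2)]
    with [q] either correlation. They share the cut, and their half-planes have equal mass but
    different slopes, so [crossing_halfplanes_neq] applies. *)
Lemma gauss_pair_orthant_lt (d : measure_display) (T : measurableType d)
  (P : probability T R) (d' : measure_display) (T' : measurableType d')
  (P' : probability T' R) (U V : T -> R) (U' V' : T' -> R) (c1 c2 r r' : R) :
  gauss_pair P U V c1 c2 1 r 1 -> gauss_pair P' U' V' c1 c2 1 r' 1 ->
  r ^+ 2 < 1 -> r' ^+ 2 < 1 -> r < r' ->
  P [set w | 0 <= U w /\ 0 <= V w] <> P' [set w | 0 <= U' w /\ 0 <= V' w].
Proof.
move=> gp gp' r1 r1' rr' PP'.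
pose t := Num.sqrt (1 - r ^+ 2); pose t' := Num.sqrt (1 - r' ^+ 2).
have t0 : 0 < t by rewrite sqrtr_gt0 subr_gt0.
have t0' : 0 < t' by rewrite sqrtr_gt0 subr_gt0.
have t2 : t ^+ 2 = 1 - r ^+ 2 by rewrite sqr_sqrtr// subr_ge0 ltW.
have t2' : t' ^+ 2 = 1 - r' ^+ 2 by rewrite sqr_sqrtr// subr_ge0 ltW.
have tn0 : t != 0 by rewrite gt_eqF.
have tn0' : t' != 0 by rewrite gt_eqF.
(* Gram-Schmidt: [X] is [U - c1], and [Y] is the part of [V - c2] uncorrelated with [X], divided by
   its standard deviation [t]. *)
have [X [Y std]] : exists X Y : T -> R, gauss_pair P X Y 0 0 1 0 1.
  have := gauss_pair_affine 1 0 (- c1) (- (r / t)) t^-1 ((r * c1 - c2) / t) gp.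
  rewrite (_ : 1 * c1 + 0 * c2 - c1 = 0); last by ring.
  rewrite (_ : - (r / t) * c1 + t^-1 * c2 + (r * c1 - c2) / t = 0); last by field.
  rewrite (_ : 1 ^+ 2 * 1 + 2 * 1 * 0 * r + 0 ^+ 2 * 1 = 1); last by ring.
  rewrite (_ : 1 * - (r / t) * 1 + (1 / t + - (r / t) * 0) * r + 0 / t * 1 = 0);
    last by field.
  rewrite (_ : (- (r / t)) ^+ 2 * 1 + 2 * - (r / t) / t * r + t^-1 ^+ 2 * 1 = 1).
    by eexists; eexists; eassumption.
  transitivity ((1 - r ^+ 2) / t ^+ 2); first by field.
  by rewrite -t2 divff// expf_neq0.
have orth (q u : R) : 0 < u -> u ^+ 2 = 1 - q ^+ 2 ->
    gauss_pair P (fun w => 1 * X w + 0 * Y w + c1) (fun w => q * X w + u * Y w + c2)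
      c1 c2 1 q 1.
  move=> u0 u2; have := gauss_pair_affine 1 0 c1 q u c2 std.
  rewrite !mulr0 !mulr1 !add0r !addr0 mul1r mul0r addr0 u2.
  by rewrite expr1n expr0n/= addr0 subrKC.
have scale (q u : R) w : 0 < u ->
    (0 <= q / u * X w + Y w + c2 / u) = (- c2 <= q * X w + u * Y w).
  move=> u0; rewrite -(pmulr_rge0 _ u0) -[RHS]subr_ge0 opprK; congr (0 <= _).
  by field; rewrite gt_eqF.
(* The form [q * X + u * Y] has variance 1, so the mass depends on [c2] alone. *)
have half (q u : R) : 0 < u -> u ^+ 2 = 1 - q ^+ 2 ->
    P [set w | 0 <= q / u * X w + Y w + c2 / u] = gauss_law 0 1 `[- c2, +oo[.
  move=> u0 u2; have := gauss_pair_halfplane q u (- c2) std.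
  rewrite !mulr0 !addr0 !mulr1 u2 subrKC => <-; congr (P _).
  by apply/seteqP; split => w /=; rewrite scale.
have set_eq (q u : R) : 0 < u ->
    [set w | 0 <= 1 * X w + 0 * Y w + c1 /\ 0 <= q * X w + u * Y w + c2] =
    [set w | 0 <= X w + c1 /\ 0 <= q / u * X w + Y w + c2 / u].
  move=> u0; apply/seteqP.
  by split => w /=; rewrite scale// mul1r mul0r addr0 -(lerBlDr 0 c2) sub0r.
have := crossing_halfplanes_neq (c1 := c1) std (slope_lt r1 r1' rr') (k := c2 / t) (k' := c2 / t').
rewrite -/t -/t'; apply; first by rewrite !half.
rewrite -!set_eq// -(gauss_pair_orthant gp (orth r t t0 t2)).
by rewrite -(gauss_pair_orthant gp' (orth r' t' t0' t2')).
Qed.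

Lemma gauss_pair_orthant_inj (d : measure_display) (T : measurableType d)
  (P : probability T R) (d' : measure_display) (T' : measurableType d')
  (P' : probability T' R) (U V : T -> R) (U' V' : T' -> R) (c1 c2 r r' : R) :
  gauss_pair P U V c1 c2 1 r 1 -> gauss_pair P' U' V' c1 c2 1 r' 1 ->
  r ^+ 2 < 1 -> r' ^+ 2 < 1 ->
  P [set w | 0 <= U w /\ 0 <= V w] = P' [set w | 0 <= U' w /\ 0 <= V' w] ->
  r = r'.
Proof.
move=> gp gp' r1 r1' PP'; case: (ltgtP r r') => // rr'.
  by have := gauss_pair_orthant_lt gp gp' r1 r1' rr' PP'.
by have := gauss_pair_orthant_lt gp' gp r1' r1 rr' (esym PP').
Qed.

(** Shifting the mean from [m'] to [m] extends the half-line by [[m - m', 0[], which has positive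
    mass. *)
Lemma gauss_law_halfline_lt (m m' : R) : m < m' ->
  gauss_law m 1 `[0, +oo[ != gauss_law m' 1 `[0, +oo[.
Proof.
move=> mm'.
have sh (k : R) : gauss_law (m + k) 1 `[0, +oo[ = gauss_law m 1 `[- k, +oo[.
  rewrite -gauss_law_shift//; congr (gauss_law m 1 _).
  by apply/seteqP; split => x /=; rewrite !in_itv/= !andbT; lra.
have := sh (m' - m); rewrite subrKC opprB => ->.
pose A : set R := `[m - m', 0[%classic; pose B : set R := `[0, +oo[%classic.
have -> : `[m - m', +oo[%classic = A `|` B.
  by apply: itv_bndbnd_setU; rewrite bnd_simp; lra.
have mA : measurable A by exact: measurable_itv.
have mB : measurable B by exact: measurable_itv.
have pos : (0 < gauss_law m 1 A)%E by apply: gauss_law_itv_gt0; lra.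
have fin : gauss_law m 1 B \is a fin_num by exact: gauss_law_fin_num.
rewrite gauss_lawU//; last first.
  by apply/seteqP; split => x //=; rewrite /A /B/= !in_itv/= andbT => -[]; lra.
by rewrite lt_eqF// lteDr.
Qed.

Lemma gauss_law_halfline_inj (m m' : R) :
  gauss_law m 1 `[0, +oo[ = gauss_law m' 1 `[0, +oo[ -> m = m'.
Proof.
move=> E; case: (ltgtP m m') => // /gauss_law_halfline_lt; by rewrite E eqxx.
Qed.

End monotonicity.

(** * The covariance as a quadratic form, and its nondegeneracy *)

Section covariance_form.
Context {R : realType} {n : nat}.
Implicit Types (S : 'M[R]_n) (t f : 'I_n -> R) (i j k : 'I_n).

Definition quad_form S t : R := \sum_(i < n) \sum_(j < n) t i * S i j * t j.

(** The coefficient vector of [s * (X_i - X_j) + u * (X_j - X_k)]. *)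
Definition contrast (s u : R) i j k (l : 'I_n) : R :=
  s * ((l == i)%:R - (l == j)%:R) + u * ((l == j)%:R - (l == k)%:R).

Definition var_diff S i j : R := S i i + S j j - 2 * S i j.

(** The covariance of [X_i - X_j] and [X_j - X_k] when [X] has covariance [S]. *)
Definition cov_diff S i j k : R := S i j - S i k - S j j + S j k.

Lemma sum_delta f i : \sum_(l < n) (l == i)%:R * f l = f i.
Proof.
rewrite (bigD1 i)//= eqxx mul1r big1 ?addr0// => l /negbTE ->.
by rewrite mul0r.
Qed.

Lemma sum_contrast s u i j k f :
  \sum_(l < n) contrast s u i j k l * f l = s * (f i - f j) + u * (f j - f k).
Proof.
transitivity (s * (\sum_(l < n) (l == i)%:R * f l - \sum_(l < n) (l == j)%:R * f l)
  + u * (\sum_(l < n) (l == j)%:R * f l - \sum_(l < n) (l == k)%:R * f l)).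
  rewrite -!sumrB !mulr_sumr -big_split/=; apply: eq_bigr => l _.
  by rewrite /contrast; ring.
by rewrite !sum_delta.
Qed.

Lemma quad_form_contrast S s u i j k : S^T = S ->
  quad_form S (contrast s u i j k) =
  s ^+ 2 * var_diff S i j + 2 * s * u * cov_diff S i j k + u ^+ 2 * var_diff S j k.
Proof.
move=> symS; have sym a b : S a b = S b a by rewrite -[in LHS]symS mxE.
transitivity (\sum_(a < n) contrast s u i j k a *
   (s * (S a i - S a j) + u * (S a j - S a k))).
  apply: eq_bigr => a _; rewrite -(sum_contrast s u i j k (S a)) mulr_sumr.
  by apply: eq_bigr => b _; ring.
rewrite sum_contrast /var_diff /cov_diff (sym j i) (sym k j) (sym k i).
by ring.
Qed.

Lemma quad_formE S t : quad_form S t =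
  ((\row_l t l) *m S *m (\row_l t l)^T) ord0 ord0.
Proof.
rewrite mxE /quad_form exchange_big/=; apply: eq_bigr => b _.
by rewrite !mxE mulr_suml; apply: eq_bigr => a _; rewrite !mxE.
Qed.

(* First-order optimality at a zero of a nonnegative quadratic form. *)
Lemma psd_isotropic_kernel S (v : 'rV[R]_n) : S^T = S ->
  (forall x : 'rV[R]_n, 0 <= (x *m S *m x^T) ord0 ord0) ->
  (v *m S *m v^T) ord0 ord0 = 0 -> v *m S = 0.
Proof.
move=> symS psd v0.
pose w := v *m S.
have wE : v *m S *m w^T = w *m w^T by [].
have bE : w *m S *m v^T = w *m w^T.
  by have -> : w^T = S *m v^T; [rewrite trmx_mul symS|rewrite mulmxA].
pose g := (w *m w^T) ord0 ord0; pose h := (w *m S *m w^T) ord0 ord0.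
have gE : g = \sum_l w ord0 l ^+ 2.
  by rewrite /g mxE; apply: eq_bigr => l _; rewrite [w^T _ _]mxE expr2.
(* The form at [v + x *: w], whose constant term vanishes by [v0]; here [g] is the squared norm of
   [w]. *)
have q x : 0 <= 2 * x * g + x ^+ 2 * h.
  have := psd (v + x *: w).
  rewrite mulmxDl linearD/= linearZ/= !mulmxDl !mulmxDr -!scalemxAl -!scalemxAr.
  rewrite wE bE.
  have addE (M N : 'M[R]_1) : (M + N) ord0 ord0 = M ord0 ord0 + N ord0 ord0.
    by rewrite mxE.
  have scaleE c (M : 'M[R]_1) : (c *: M) ord0 ord0 = c * M ord0 ord0.
    by rewrite mxE.
  by rewrite !(addE, scaleE) v0 -/g -/h; lra.
have h0 : 0 <= h by exact: psd.
have g0 : 0 <= g by rewrite gE sumr_ge0// => l _; rewrite sqr_ge0.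
have gz : g = 0.
  (* A small negative multiple of [g]; the shift [h + 1] keeps the denominator positive even when
     [h] is 0. *)
  have := q (- g / (h + 1)).
  have -> : 2 * (- g / (h + 1)) * g + (- g / (h + 1)) ^+ 2 * h =
    - (g ^+ 2 * (h + 2)) / (h + 1) ^+ 2 by field; rewrite gt_eqF//; lra.
  rewrite pmulr_lge0; last by rewrite invr_gt0 exprn_gt0//; lra.
  by nra.
apply/rowP => l; rewrite [RHS]mxE -/w.
move: gz; rewrite gE => /eqP; rewrite psumr_eq0; last by move=> *; exact: sqr_ge0.
by move=> /allP/(_ l (mem_index_enum _))/=; rewrite sqrf_eq0 => /eqP.
Qed.

(** An isotropic vector lies in the kernel of [S], which is a line by the rank condition and
    contains the all-ones vector. *)
Lemma probit_isotropic_constant (mu : 'I_n -> R) S t : (0 < n)%N ->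
  probit_normalized mu S -> quad_form S t = 0 -> forall i j, t i = t j.
Proof.
move=> n0 [_ [symS [psd [rows [_ rkS]]]]]; rewrite quad_formE => Q0.
have tker : ((\row_l t l) <= kermx S)%MS.
  by apply/sub_kermxP; exact: psd_isotropic_kernel Q0.
pose one : 'rV[R]_n := const_mx 1.
have oneker : (one <= kermx S)%MS.
  apply/sub_kermxP/rowP => j; rewrite !mxE -[RHS](rows j).
  by apply: eq_bigr => i _; rewrite mxE mul1r -[in RHS]symS mxE.
have one0 : one != 0.
  by apply/negP => /eqP/rowP/(_ (Ordinal n0)); rewrite !mxE; apply/eqP/oner_neq0.
have kone : (kermx S <= one)%MS.
  rewrite -(geq_leqif (mxrank_leqif_sup oneker)) mxrank_ker rkS rank_rV one0.
  by case: (n) n0 => // m _; rewrite subSnn.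
have /sub_rVP[c /rowP E] := submx_trans tker kone.
by move=> i j; have := E i; have := E j; rewrite !mxE => -> ->.
Qed.

Section nondegeneracy.
Context (mu : 'I_n -> R) (S : 'M[R]_n).
Hypothesis norm : probit_normalized mu S.
Context (i j k : 'I_n).
Hypotheses (ij : i != j) (jk : j != k) (ik : i != k).

Let n_gt0 : (0 < n)%N. Proof. exact: leq_ltn_trans (ltn_ord i). Qed.

Let symS : S^T = S. Proof. by case: norm => _ []. Qed.

Lemma quad_form_ge0 t : 0 <= quad_form S t.
Proof. by rewrite quad_formE; case: norm => _ [_ [psd _]]; exact: psd. Qed.

(** At [i], [j], [k] the values are [s], [u - s], [- u], which agree only for [s = u = 0]. *)
Lemma contrast_nonconst s u : (s, u) != (0, 0) ->
  ~ forall a b, contrast s u i j k a = contrast s u i j k b.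
Proof.
move=> su C; have := C i j; have := C j k; rewrite /contrast !eqxx.
rewrite [j == i]eq_sym [k == i]eq_sym [k == j]eq_sym.
rewrite (negbTE ij) (negbTE jk) (negbTE ik)/= => e1 e2.
have s0 : s = 0 by lra.
have u0 : u = 0 by lra.
by move: su; rewrite s0 u0 eqxx.
Qed.

Lemma quad_form_contrast_gt0 s u : (s, u) != (0, 0) ->
  0 < s ^+ 2 * var_diff S i j + 2 * s * u * cov_diff S i j k + u ^+ 2 * var_diff S j k.
Proof.
move=> su; rewrite -quad_form_contrast// lt0r quad_form_ge0 andbT.
apply/eqP => /(probit_isotropic_constant n_gt0 norm).
exact: contrast_nonconst.
Qed.

Lemma var_diff_gt0 : 0 < var_diff S i j.
Proof.
have := @quad_form_contrast_gt0 1 0; rewrite xpair_eqE oner_eq0 => /(_ isT).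
by lra.
Qed.

(** Strict Cauchy-Schwarz: at [s = var_diff S j k] and [u = - cov_diff S i j k] the positive form
    factors as [var_diff S j k] times the difference of the two sides. *)
Lemma cov_diff_sqr_lt : cov_diff S i j k ^+ 2 < var_diff S i j * var_diff S j k.
Proof.
have vjk : 0 < var_diff S j k.
  have := @quad_form_contrast_gt0 0 1; rewrite xpair_eqE oner_eq0 andbF => /(_ isT).
  by lra.
have := @quad_form_contrast_gt0 (var_diff S j k) (- cov_diff S i j k).
rewrite xpair_eqE (gt_eqF vjk)/= => /(_ isT).
rewrite [X in 0 < X](_ : _ = var_diff S j k *
  (var_diff S i j * var_diff S j k - cov_diff S i j k ^+ 2)); last by ring.
by rewrite pmulr_rgt0// subr_gt0.
Qed.

End nondegeneracy.

Lemma var_diffC S i j : S^T = S -> var_diff S i j = var_diff S j i.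
Proof.
by move=> symS; rewrite /var_diff -[in S i j]symS mxE [S i i + _]addrC.
Qed.

(** Rows of [S] sum to 0, so summing [var_diff S i j] over [j] gives [n * S i i + \tr S]. With the
    trace known this yields the diagonal, then every entry. *)
Lemma var_diff_inj (mu mu' : 'I_n -> R) S S' : (0 < n)%N ->
  probit_normalized mu S -> probit_normalized mu' S' ->
  (forall i j, var_diff S i j = var_diff S' i j) -> S = S'.
Proof.
move=> n0 [_ [_ [_ [rows [trS _]]]]] [_ [_ [_ [rows' [trS' _]]]]] vv'.
have diag (M : 'M[R]_n) i : (forall i, \sum_j M i j = 0) ->
    \sum_j var_diff M i j = n%:R * M i i + \tr M.
  move=> rM; rewrite /var_diff sumrB big_split/= sumr_const card_ord.
  by rewrite -mulr_sumr rM mulr0 subr0 mulr_natl.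
have dd i : S i i = S' i i.
  have E : \sum_j var_diff S i j = \sum_j var_diff S' i j by apply: eq_bigr.
  move: E; rewrite !diag// trS trS' => /addIr; apply: mulfI.
  by rewrite pnatr_eq0 -lt0n.
by apply/matrixP => i j; have := vv' i j; rewrite /var_diff !dd; lra.
Qed.

Lemma mean_diff_inj (mu mu' : 'I_n -> R) S S' : (0 < n)%N ->
  probit_normalized mu S -> probit_normalized mu' S' ->
  (forall i j, mu i - mu j = mu' i - mu' j) -> mu = mu'.
Proof.
move=> n0 [m0 _] [m0' _] dd; apply/funext => i.
have sumE (m : 'I_n -> R) : \sum_j m j = 0 -> \sum_j (m i - m j) = n%:R * m i.
  by move=> mz; rewrite sumrB mz subr0 sumr_const card_ord mulr_natl.
have : \sum_j (mu i - mu j) = \sum_j (mu' i - mu' j) by apply: eq_bigr.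
by rewrite !sumE//; apply: mulfI; rewrite pnatr_eq0 -lt0n.
Qed.

End covariance_form.

(** * Standardized differences and pairwise probabilities *)

Section gaussian_vector.
Context {R : realType} {n : nat}.
Context (d : measure_display) (T : measurableType d) (P : probability T R).
Context (X : 'I_n -> T -> R) (mu : 'I_n -> R) (S : 'M[R]_n).
Hypotheses (norm : probit_normalized mu S) (gauss : is_gaussian_vector P X mu S).

Definition sd_diff (V : 'M[R]_n) (i j : 'I_n) : R := Num.sqrt (var_diff V i j).

(** Minus the cosine of the angle at [j] in the triangle with sides [sd_diff]: one difference points
    away from [j], the other towards it. *)
Definition corr_diff (V : 'M[R]_n) (i j k : 'I_n) : R :=
  cov_diff V i j k / (sd_diff V i j * sd_diff V j k).

Let mX i : measurable_fun setT (X i). Proof. by case: gauss. Qed.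

Lemma gauss_pair_diff i j k :
  gauss_pair P (fun w => X i w - X j w) (fun w => X j w - X k w)
    (mu i - mu j) (mu j - mu k)
    (var_diff S i j) (cov_diff S i j k) (var_diff S j k).
Proof.
have symS : S^T = S by case: norm => _ [].
split; [exact: measurable_funB|exact: measurable_funB| |].
  by move=> s t; rewrite -quad_form_contrast//; exact: (quad_form_ge0 norm).
move=> s t A mA; have [_ law] := gauss.
rewrite -quad_form_contrast// -(sum_contrast s t i j k mu) -law//.
congr (P (_ @^-1` A)); apply/funext => w.
by rewrite (sum_contrast s t i j k (fun l => X l w)).
Qed.

Lemma sd_diff_gt0 i j k : i != j -> j != k -> i != k -> 0 < sd_diff S i j.
Proof. by move=> ij jk ik; rewrite sqrtr_gt0 (var_diff_gt0 norm ij jk ik). Qed.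

Lemma sd_diff_sqr i j k : i != j -> j != k -> i != k ->
  sd_diff S i j ^+ 2 = var_diff S i j.
Proof. by move=> ij jk ik; rewrite sqr_sqrtr// ltW// (var_diff_gt0 norm ij jk ik). Qed.

Lemma gauss_pair_standardized i j k : i != j -> j != k -> i != k ->
  gauss_pair P (fun w => (sd_diff S i j)^-1 * (X i w - X j w))
    (fun w => (sd_diff S j k)^-1 * (X j w - X k w))
    ((mu i - mu j) / sd_diff S i j) ((mu j - mu k) / sd_diff S j k)
    1 (corr_diff S i j k) 1.
Proof.
move=> ij jk ik.
have ji : j != i by rewrite eq_sym.
have ki : k != i by rewrite eq_sym.
have kj : k != j by rewrite eq_sym.
have a0 := sd_diff_gt0 ij jk ik; have b0 := sd_diff_gt0 jk ki ji.
have a2 := sd_diff_sqr ij jk ik; have b2 := sd_diff_sqr jk ki ji.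
have := gauss_pair_affine (sd_diff S i j)^-1 0 0 0 (sd_diff S j k)^-1 0
  (gauss_pair_diff i j k).
rewrite (_ : (fun w => (sd_diff S i j)^-1 * _ + 0 * _ + 0) =
  (fun w => (sd_diff S i j)^-1 * (X i w - X j w))); last first.
  by apply/funext => w; rewrite mul0r !addr0.
rewrite (_ : (fun w => 0 * _ + _ + 0) =
  (fun w => (sd_diff S j k)^-1 * (X j w - X k w))); last first.
  by apply/funext => w; rewrite mul0r add0r addr0.
rewrite -a2 -b2 /corr_diff.
set a := sd_diff S i j in a0 *; set b := sd_diff S j k in b0 *.
have an0 : a != 0 by rewrite gt_eqF.
have bn0 : b != 0 by rewrite gt_eqF.
rewrite (_ : a^-1 * _ + _ + 0 = (mu i - mu j) / a); last by field.
rewrite (_ : 0 * _ + b^-1 * _ + 0 = (mu j - mu k) / b); last by field.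
rewrite (_ : a^-1 ^+ 2 * _ + _ + _ = 1); last by field.
rewrite (_ : a^-1 * 0 * _ + _ + _ = cov_diff S i j k / (a * b)); last first.
  by field; rewrite an0 bn0.
by rewrite (_ : 0 ^+ 2 * _ + _ + _ = 1)//; field.
Qed.

Lemma corr_diff_sqr_lt1 i j k : i != j -> j != k -> i != k ->
  corr_diff S i j k ^+ 2 < 1.
Proof.
move=> ij jk ik.
have ji : j != i by rewrite eq_sym.
have ki : k != i by rewrite eq_sym.
have a0 := sd_diff_gt0 ij jk ik; have b0 := sd_diff_gt0 jk ki ji.
rewrite /corr_diff exprMn exprVn ltr_pdivrMr; last by rewrite exprn_gt0// mulr_gt0.
rewrite mul1r exprMn (sd_diff_sqr ij jk ik) (sd_diff_sqr jk ki ji).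
exact: (cov_diff_sqr_lt norm ij jk ik).
Qed.

Lemma order_event i j k : i != j -> j != k -> i != k ->
  [set w | X j w <= X i w /\ X k w <= X j w] =
  [set w | 0 <= (sd_diff S i j)^-1 * (X i w - X j w) /\
           0 <= (sd_diff S j k)^-1 * (X j w - X k w)].
Proof.
move=> ij jk ik.
have ji : j != i by rewrite eq_sym.
have ki : k != i by rewrite eq_sym.
have a0 := sd_diff_gt0 ij jk ik; have b0 := sd_diff_gt0 jk ki ji.
by apply/seteqP; split => w /=; rewrite !pmulr_rge0 ?invr_gt0// !subr_ge0.
Qed.

Lemma pairwise_probability i j k : i != j -> j != k -> i != k ->
  P [set w | X j w <= X i w] =
  gauss_law ((mu i - mu j) / sd_diff S i j) 1 `[0, +oo[.
Proof.
move=> ij jk ik.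
have := gauss_pair_halfplane 1 0 0 (gauss_pair_standardized ij jk ik).
rewrite (_ : 1 * _ + 0 * _ = (mu i - mu j) / sd_diff S i j); last by ring.
rewrite (_ : 1 ^+ 2 * 1 + _ + _ = 1); last by ring.
move=> <-.
congr (P _); apply/seteqP; split => w /=;
  by rewrite mul1r mul0r addr0 pmulr_rge0 ?subr_ge0// invr_gt0 (sd_diff_gt0 ij jk ik).
Qed.

(** The difference has positive variance, so its law has no atom at 0. *)
Lemma tie_null i j k : i != j -> j != k -> i != k ->
  P [set w | X i w = X j w] = 0%E.
Proof.
move=> ij jk ik; have [_ _ _ law] := gauss_pair_diff i j k.
have := law 1 0 [set 0] (measurable_set1 _).
rewrite gauss_law_set1; last first.
  by have := var_diff_gt0 norm ij jk ik; lra.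
move=> <-; congr (P _); apply/seteqP; split => w /=; lra.
Qed.

(** The three terms place [k] below, between and above; they overlap only in ties, which are
    null. *)
Lemma pairwise_three_way i j k : i != j -> j != k -> i != k ->
  P [set w | X j w <= X i w] =
  (P [set w | X j w <= X i w /\ X k w <= X j w]%R +
   P [set w | X k w <= X i w /\ X j w <= X k w]%R +
   P [set w | X i w <= X k w /\ X j w <= X i w]%R)%E.
Proof.
move=> ij jk ik.
have ki : k != i by rewrite eq_sym.
have kj : k != j by rewrite eq_sym.
have ji : j != i by rewrite eq_sym.
pose E a b c := [set w | X b w <= X a w /\ X c w <= X b w].
have mE a b c : measurable (E a b c).
  apply: (measurableI [set w | X b w <= X a w] [set w | X c w <= X b w]);
  exact: measurable_half_space.
have mtie a b : measurable [set w | X a w = X b w].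
  rewrite (_ : [set w | X a w = X b w] =
    [set w | X a w <= X b w] `&` [set w | X b w <= X a w]).
    by apply: measurableI; exact: measurable_half_space.
  by apply/seteqP; split => w /=; [move=> ->|move=> [? ?]; apply/eqP; rewrite eq_le; apply/andP].
have PU (A B N : set T) : measurable A -> measurable B -> measurable N ->
    A `&` B `<=` N -> P N = 0%E -> P (A `|` B) = (P A + P B)%E.
  move=> mA mB mN sub N0.
  rewrite measureUfinr -?ge0_fin_numE ?fin_num_measure//=.
  by rewrite (subset_measure0 _ mN sub N0) ?sube0//; exact: measurableI.
have s1 : E i j k `&` E i k j `<=` [set w | X j w = X k w].
  by move=> w [[? ?] [? ?]] /=; lra.
have s2 : (E i j k `|` E i k j) `&` E k i j `<=` [set w | X i w = X k w].
  by move=> w [[[? ?]|[? ?]] [? ?]] /=; lra.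
rewrite -[X in (X + _ + _)%E]/(P (E i j k)) -[X in (_ + X + _)%E]/(P (E i k j)).
rewrite -[X in (_ + _ + X)%E]/(P (E k i j)).
rewrite -(PU _ _ _ (mE _ _ _) (mE _ _ _) (mtie _ _) s1 (tie_null jk ki ji)).
rewrite -(PU _ _ _ (measurableU _ _ (mE _ _ _) (mE _ _ _)) (mE _ _ _) (mtie _ _)
  s2 (tie_null ik kj ij)).
congr (P _); apply/seteqP; split => w /=.
  move=> h; have [jk'|jk'] := leP (X k w) (X j w); first by left; left.
  have [ik'|ik'] := leP (X k w) (X i w); first by left; right; split => //; exact: ltW.
  by right; split => //; exact: ltW.
by move=> [[[]|[]]|[]]; lra.
Qed.

End gaussian_vector.

(* Adding two law-of-cosines identities and dividing by a side gives a relation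
   linear in the sides, so the cosines determine the triangle up to scale. *)
Lemma triangle_cosines_inj (R : realType) (a b c a' b' c' ra rb rc : R) :
  0 < a -> 0 < b -> 0 < c -> 0 < a' -> 0 < b' -> 0 < c' -> rc ^+ 2 < 1 ->
  c ^+ 2 - a ^+ 2 - b ^+ 2 = 2 * rc * (a * b) ->
  a ^+ 2 - b ^+ 2 - c ^+ 2 = 2 * ra * (b * c) ->
  b ^+ 2 - c ^+ 2 - a ^+ 2 = 2 * rb * (c * a) ->
  c' ^+ 2 - a' ^+ 2 - b' ^+ 2 = 2 * rc * (a' * b') ->
  a' ^+ 2 - b' ^+ 2 - c' ^+ 2 = 2 * ra * (b' * c') ->
  b' ^+ 2 - c' ^+ 2 - a' ^+ 2 = 2 * rb * (c' * a') ->
  a ^+ 2 + b ^+ 2 + c ^+ 2 = a' ^+ 2 + b' ^+ 2 + c' ^+ 2 ->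
  a = a'.
Proof.
move=> a0 b0 c0 a0' b0' c0' rc1 e1 e2 e3 e1' e2' e3' tr.
(* Eliminating one of [x], [y] between the two linear relations expresses the other by [z]; since
   [rc ^+ 2 < 1], the cosines determine both ratios to [z]. *)
have lin (x y z : R) : 0 < x -> 0 < y -> 0 < z ->
    z ^+ 2 - x ^+ 2 - y ^+ 2 = 2 * rc * (x * y) ->
    x ^+ 2 - y ^+ 2 - z ^+ 2 = 2 * ra * (y * z) ->
    y ^+ 2 - z ^+ 2 - x ^+ 2 = 2 * rb * (z * x) ->
    (1 - rc ^+ 2) * x = (rc * ra - rb) * z /\ (1 - rc ^+ 2) * y = (rc * rb - ra) * z.
  move=> x0 y0 z0 f1 f2 f3.
  have l1 : y = - (rc * x + ra * z).
    by apply: (mulfI (lt0r_neq0 y0)); lra.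
  have l2 : x = - (rc * y + rb * z).
    by apply: (mulfI (lt0r_neq0 x0)); lra.
  split.
    have : rc * y = rc * - (rc * x + ra * z) by rewrite -l1.
    by lra.
  have : rc * x = rc * - (rc * y + rb * z) by rewrite -l2.
  by lra.
have [ha hb] := lin _ _ _ a0 b0 c0 e1 e2 e3.
have [ha' hb'] := lin _ _ _ a0' b0' c0' e1' e2' e3'.
have d0 : 1 - rc ^+ 2 != 0 by rewrite subr_eq0 eq_sym lt_eqF.
have pa : a * c' = a' * c.
  apply: (mulfI d0); rewrite !mulrA ha ha'; ring.
have pb : b * c' = b' * c.
  apply: (mulfI d0); rewrite !mulrA hb hb'; ring.
(* The triangles are similar, and equal sums of squares force the scale to be 1. *)
have cc : c = c'.
  have s0 : a ^+ 2 + b ^+ 2 + c ^+ 2 != 0.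
    by rewrite gt_eqF// !addr_gt0 ?exprn_gt0.
  apply/eqP; rewrite -(eqrXn2 (n := 2)) ?ltW//; apply/eqP/(mulfI s0).
  rewrite [in LHS]tr !mulrDl -!exprMn -pa -pb.
  by ring.
by move: pa; rewrite cc => /(mulIf (lt0r_neq0 c0')).
Qed.

(** * The triangle of standard deviations under the normalization *)

Section normalized_triangle.
Context {R : realType}.

(** Up to sign [X_k - X_i] is the sum of [X_i - X_j] and [X_j - X_k]; hence the plus sign on the
    right. *)
Lemma law_of_cosines (n : nat) (mu : 'I_n -> R) (S : 'M[R]_n) (i j k : 'I_n) :
  probit_normalized mu S -> i != j -> j != k -> i != k ->
  sd_diff S k i ^+ 2 - sd_diff S i j ^+ 2 - sd_diff S j k ^+ 2 =
  2 * corr_diff S i j k * (sd_diff S i j * sd_diff S j k).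
Proof.
move=> norm ij jk ik.
have ji : j != i by rewrite eq_sym.
have ki : k != i by rewrite eq_sym.
have symS : S^T = S by case: norm => _ [].
rewrite /corr_diff -[RHS]mulrA divfK; last first.
  by rewrite mulf_neq0// gt_eqF// ?(sd_diff_gt0 norm ij jk ik) ?(sd_diff_gt0 norm jk ki ji).
have kj : k != j by rewrite eq_sym.
rewrite (sd_diff_sqr norm ij jk ik) (sd_diff_sqr norm jk ki ji) (sd_diff_sqr norm ki ij kj).
by rewrite (var_diffC k i symS) /var_diff /cov_diff; ring.
Qed.

Lemma sum_ord3 (i j k : 'I_3) (f : 'I_3 -> R) : i != j -> j != k -> i != k ->
  \sum_l f l = f i + f j + f k.
Proof.
move=> ij jk ik; rewrite (bigD1 i)//= (bigD1 j) 1?eq_sym//= (bigD1 k)/=; last first.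
  by rewrite ![k == _]eq_sym ik jk.
rewrite big1 ?addr0 ?addrA// => l /andP[/andP[li lj] lk].
by case: i j k l ij jk ik li lj lk => [[|[|[|?]]] ?] [[|[|[|?]]] ?] [[|[|[|?]]] ?] [[|[|[|?]]] ?].
Qed.

Lemma ord3_third (i j : 'I_3) : i != j -> exists k : 'I_3, j != k /\ i != k.
Proof.
move=> ij; pose o m (h : (m < 3)%N) : 'I_3 := Ordinal h.
case: i j ij => [[|[|[|?]]] ?] [[|[|[|?]]] ?]// _;
  by [exists (o 0 isT)|exists (o 1 isT)|exists (o 2 isT)].
Qed.

(** The sum is [3 * \tr S]: twice the trace from the diagonal, and once more from the off-diagonal
    entries because all entries sum to 0. *)
Lemma sum_var_diff (mu : 'I_3 -> R) (S : 'M[R]_3) (i j k : 'I_3) :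
  probit_normalized mu S -> i != j -> j != k -> i != k ->
  sd_diff S i j ^+ 2 + sd_diff S j k ^+ 2 + sd_diff S k i ^+ 2 = 9.
Proof.
move=> norm ij jk ik.
have ji : j != i by rewrite eq_sym.
have ki : k != i by rewrite eq_sym.
have kj : k != j by rewrite eq_sym.
rewrite (sd_diff_sqr norm ij jk ik) (sd_diff_sqr norm jk ki ji) (sd_diff_sqr norm ki ij kj).
have [_ [symS [_ [rows [trS _]]]]] := norm.
have sym a b : S a b = S b a by rewrite -[in LHS]symS mxE.
move: trS (rows i) (rows j) (rows k); rewrite /mxtrace !(sum_ord3 _ ij jk ik).
rewrite /var_diff (sym j i) (sym k j) (sym k i); lra.
Qed.

End normalized_triangle.

Theorem theorem2 (R : realType)
  (d : measure_display) (T : measurableType d) (P : probability T R)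
  (d' : measure_display) (T' : measurableType d') (P' : probability T' R)
  (mu mu' : 'I_3 -> R) (S S' : 'M[R]_3)
  (X : 'I_3 -> T -> R) (X' : 'I_3 -> T' -> R) :
  probit_normalized mu S ->
  probit_normalized mu' S' ->
  is_gaussian_vector P X mu S ->
  is_gaussian_vector P' X' mu' S' ->
  (forall i j k : 'I_3, i != j -> j != k -> i != k ->
     P [set w | X j w <= X i w /\ X k w <= X j w] =
     P' [set w | X' j w <= X' i w /\ X' k w <= X' j w]) ->
  mu = mu' /\ S = S'.
Proof.
move=> norm norm' gauss gauss' three_way.
(* Three-way probabilities add up to pairwise ones, and these determine the standardized mean
   differences. *)
have zscore i j k : i != j -> j != k -> i != k ->
    (mu i - mu j) / sd_diff S i j = (mu' i - mu' j) / sd_diff S' i j.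
  move=> ij jk ik; apply: gauss_law_halfline_inj.
  have ki : k != i by rewrite eq_sym.
  have kj : k != j by rewrite eq_sym.
  rewrite -(pairwise_probability norm gauss ij jk ik).
  rewrite -(pairwise_probability norm' gauss' ij jk ik).
  rewrite (pairwise_three_way norm gauss ij jk ik).
  rewrite (pairwise_three_way norm' gauss' ij jk ik).
  by rewrite (three_way i j k)// (three_way i k j)// (three_way k i j).
(* By [zscore] the two standardized pairs have equal means, so only the correlation can differ. *)
have corr i j k : i != j -> j != k -> i != k ->
    corr_diff S i j k = corr_diff S' i j k.
  move=> ij jk ik.
  have ji : j != i by rewrite eq_sym.
  have ki : k != i by rewrite eq_sym.
  have gp := gauss_pair_standardized norm gauss ij jk ik.
  have gp' := gauss_pair_standardized norm' gauss' ij jk ik.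
  rewrite (zscore _ _ _ ij jk ik) (zscore _ _ _ jk ki ji) in gp.
  apply: (gauss_pair_orthant_inj gp gp').
  - exact: (corr_diff_sqr_lt1 norm ij jk ik).
  - exact: (corr_diff_sqr_lt1 norm' ij jk ik).
  rewrite -(order_event X norm ij jk ik) -(order_event X' norm' ij jk ik).
  exact: three_way.
(* Cyclic relabelling supplies all three cosines, and the trace gives both triangles the same sum of
   squared sides. *)
have sd i j k : i != j -> j != k -> i != k -> sd_diff S i j = sd_diff S' i j.
  move=> ij jk ik.
  have ji : j != i by rewrite eq_sym.
  have ki : k != i by rewrite eq_sym.
  have kj : k != j by rewrite eq_sym.
  apply: (@triangle_cosines_inj _ _ (sd_diff S j k) (sd_diff S k i)
    _ (sd_diff S' j k) (sd_diff S' k i)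
    (corr_diff S j k i) (corr_diff S k i j) (corr_diff S i j k)).
  - exact: (sd_diff_gt0 norm ij jk ik).
  - exact: (sd_diff_gt0 norm jk ki ji).
  - exact: (sd_diff_gt0 norm ki ij kj).
  - exact: (sd_diff_gt0 norm' ij jk ik).
  - exact: (sd_diff_gt0 norm' jk ki ji).
  - exact: (sd_diff_gt0 norm' ki ij kj).
  - exact: (corr_diff_sqr_lt1 norm ij jk ik).
  - exact: (law_of_cosines norm ij jk ik).
  - exact: (law_of_cosines norm jk ki ji).
  - exact: (law_of_cosines norm ki ij kj).
  - by rewrite (corr _ _ _ ij jk ik); exact: (law_of_cosines norm' ij jk ik).
  - by rewrite (corr _ _ _ jk ki ji); exact: (law_of_cosines norm' jk ki ji).
  - by rewrite (corr _ _ _ ki ij kj); exact: (law_of_cosines norm' ki ij kj).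
  - by rewrite (sum_var_diff norm ij jk ik) (sum_var_diff norm' ij jk ik).
split.
  (* Mean differences are the z-scores multiplied by the common standard deviations. *)
  apply: (mean_diff_inj _ norm norm') => // i j.
  have [->|ij] := eqVneq i j; first by rewrite !subrr.
  have [k [jk ik]] := ord3_third ij.
  have := zscore _ _ _ ij jk ik; rewrite (sd _ _ _ ij jk ik); apply: mulIf.
  by rewrite invr_neq0// gt_eqF// (sd_diff_gt0 norm' ij jk ik).
apply: (var_diff_inj _ norm norm') => // i j.
have [->|ij] := eqVneq i j; first by rewrite /var_diff; ring.
have [k [jk ik]] := ord3_third ij.
by rewrite -(sd_diff_sqr norm ij jk ik) -(sd_diff_sqr norm' ij jk ik) (sd _ _ _ ij jk ik).
Qed.
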